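(* Let $L$ be a principal MS-algebra and $L'$ a subalgebra of $L$. Then $L$ is a perfect extension of $L'$ if and only if (1) the lattice $D(L)$ is a perfect extension of its sublattice $D(L')$, and (2) the de Morgan algebra $L^{\circ\circ}$ is a perfect extension of its subalgebra $(L')^{\circ\circ}$.
   Context: An MS-algebra is an algebra $(L;\vee,\wedge,{}^{\circ},0,1)$ where $(L;\vee,\wedge,0,1)$ is a bounded distributive lattice and ${}^{\circ}$ is a unary operation with $x\le x^{\circ\circ}$, $(x\wedge y)^{\circ}=x^{\circ}\vee y^{\circ}$ and $1^{\circ}=0$. For an MS-algebra $L$: $L^{\circ\circ}=\{x\in L\mid x=x^{\circ\circ}\}$ is a subalgebra which is a de Morgan algebra (MS-algebra with $x=x^{\circ\circ}$), and $D(L)=\{x\in L\mid x^{\circ}=0\}$ is a filter (a sublattice). $L$ is a principal MS-algebra if there is $d_L\in L$ with $D(L)=\{x\mid x\ge d_L\}$ and $x=x^{\circ\circ}\wedge(x\vee d_L)$ for all $x\in L$. For a subalgebra $L'$ of $L$, $D(L')=\{x\in L'\mid x^{\circ}=0\}$ and $(L')^{\circ\circ}=\{x\in L'\mid x=x^{\circ\circ}\}$. An algebra $A$ is a perfect extension of a subalgebra $B$ if every congruence of $B$ has exactly one extension to a congruence of $A$ (i.e. exactly one $\theta\in\mathrm{Con}(A)$ whose restriction to $B$ is it).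
   Formalization: The subalgebra L' is additionally assumed to be itself a principal MS-algebra; for arbitrary subalgebras the ''only if'' part fails, e.g. L={0,x,a,d,1} with 0<x<a,d<1, 0°=1, x°=a°=a, d°=1°=0, and L'={0,x,a,1}. *)

(* Defs.v *)
From HB Require Import structures.
From mathcomp Require Import all_boot all_order.
From mathcomp Require Import boolp classical_sets.

Set Implicit Arguments.
Unset Strict Implicit.
Unset Printing Implicit Defensive.

Import Order.Theory.
Local Open Scope classical_set_scope.
Local Open Scope order_scope.

HB.mixin Record TBDistrLattice_isMSAlgebra (d : Order.disp_t) L
    of Order.TBDistrLattice d L := {
  ms_neg : L -> L;
  ms_le_negneg : forall x : L, x <= ms_neg (ms_neg x);
  ms_negI : forall x y : L, ms_neg (x `&` y) = ms_neg x `|` ms_neg y;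
  ms_neg1 : ms_neg \top = \bot;
}.

#[short(type="msAlgebraType")]
HB.structure Definition MSAlgebra (d : Order.disp_t) :=
  { L of TBDistrLattice_isMSAlgebra d L & Order.TBDistrLattice d L }.

Notation "x °" := (ms_neg x) (at level 2, left associativity, format "x °").

Section MSAlgebraTheory.
Context {d : Order.disp_t} {L : msAlgebraType d}.
Implicit Types (A B : set L) (x y : L).

Definition sublattice A : Prop :=
  forall x y, A x -> A y -> A (x `&` y) /\ A (x `|` y).

Definition ms_subalgebra A : Prop :=
  [/\ A \bot, A \top, sublattice A & forall x, A x -> A x°].

(* [dense A] is D(A) and [skeleton A] is the set of closed elements of A; the
   algebra L itself corresponds to A = setT. *)
Definition dense A : set L := [set x | A x /\ x° = \bot].
Definition skeleton A : set L := [set x | A x /\ x = x°°].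

(* A subalgebra A is principal when it is a principal MS-algebra in its own
   right; the generator of D(A) must belong to A.  This is not inherited from
   L: take L = {0, x, a, d, 1} with x < a < 1, x < d < 1, a and d incomparable,
   0° = 1, x° = a° = a and d° = 1° = 0, which is principal with generator d.
   Its subalgebra {0, x, a, 1} is not principal.  Moreover L is a perfect
   extension of it (both congruence lattices are 3-element chains), although
   D(L) = {d, 1} is not a perfect extension of {1}. *)
Definition principal A : Prop :=
  exists2 dA : L, A dA &
    dense A = [set x | A x /\ dA <= x] /\
    forall x, A x -> x = x°° `&` (x `|` dA).

(* Congruences of a subalgebra with carrier A are sets of pairs included in
   A x A, so that equality of congruences is equality of sets.  The nullary
   operations impose no condition. *)
Definition lattice_congruence A (theta : set (L * L)) : Prop :=
  [/\ theta `<=` A `*` A,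
      forall x, A x -> theta (x, x),
      forall x y, theta (x, y) -> theta (y, x),
      forall x y z, theta (x, y) -> theta (y, z) -> theta (x, z) &
      forall x y u v, theta (x, y) -> theta (u, v) ->
        theta (x `&` u, y `&` v) /\ theta (x `|` u, y `|` v)].

Definition ms_congruence A (theta : set (L * L)) : Prop :=
  lattice_congruence A theta /\
  forall x y, theta (x, y) -> theta (x°, y°).

Definition perfect_extension (Con : set L -> set (L * L) -> Prop) A B : Prop :=
  forall phi, Con B phi ->
    exists! theta, Con A theta /\ (theta `&` (B `*` B))%classic = phi.

Lemma ms_negS x y : x <= y -> y° <= x°.
Proof. by move=> /meet_idPl e; rewrite -e ms_negI leUr. Qed.

Lemma ms_negnegneg x : x°°° = x°.
Proof.
by apply/le_anti; rewrite ms_le_negneg (ms_negS (ms_le_negneg x)).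
Qed.

Lemma ms_negU x y : (x `|` y)° = x° `&` y°.
Proof.
apply/le_anti/andP; split; first by rewrite lexI !ms_negS ?leUl ?leUr.
rewrite (le_trans (ms_le_negneg _)) // ms_negS // ms_negI.
by rewrite leU2 // ms_le_negneg.
Qed.

Lemma ms_neg0 : (\bot : L)° = \top.
Proof. by apply/le_anti; rewrite lex1 -ms_neg1 ms_le_negneg. Qed.

Lemma ms_subalgebraT : ms_subalgebra [set: L].
Proof. by []. Qed.

Lemma dense_sublattice A : ms_subalgebra A -> sublattice (dense A).
Proof.
move=> [_ _ Alat _] x y [Ax x0] [Ay y0]; have [AI AU] := Alat _ _ Ax Ay.
by split; split=> //; rewrite ?ms_negI ?ms_negU x0 y0 ?joinxx ?meetxx.
Qed.

Lemma skeleton_subalgebra A : ms_subalgebra A -> ms_subalgebra (skeleton A).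
Proof.
move=> [A0 A1 Alat AN]; split.
- by split=> //; rewrite ms_neg0 ms_neg1.
- by split=> //; rewrite ms_neg1 ms_neg0.
- move=> x y [Ax ex] [Ay ey]; have [AI AU] := Alat _ _ Ax Ay.
  by split; split=> //; rewrite ?(ms_negI, ms_negU) -ex -ey.
- by move=> x [Ax ex]; split; [exact: AN | rewrite ms_negnegneg].
Qed.

End MSAlgebraTheory.

(* Main.v *)
(** A congruence [theta] of a principal MS-algebra with generator [e] is
    determined by its restrictions to the skeleton and to the dense elements,
    because [x = x°° `&` (x `|` e)]; conversely congruences [theta1] and
    [theta2] of these two parts glue as soon as [theta1 (a, b)] implies
    [theta2 (a `|` e, b `|` e)].  Each side of the equivalence forces the
    generators of [L] and of [L'] to coincide, since identifying [x] and [y]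
    when [x `|` e' = y `|` e'], where [e'] generates [D(L')], is invisible on
    [L'].  The extensions then correspond componentwise; that extensions of a
    compatible pair are again compatible follows from uniqueness: the part of
    [theta1] that is compatible with [theta2] is itself an extension. *)
Require Import Defs.
From mathcomp Require Import all_boot all_order.
From mathcomp Require Import boolp classical_sets.

Import Order.Theory.

Section CongruencePairs.
Set Implicit Arguments.
Unset Strict Implicit.
Local Open Scope classical_set_scope.
Local Open Scope order_scope.
Context {d : Order.disp_t} {L : msAlgebraType d}.
Implicit Types (A B C : set L) (theta : set (L * L)) (x y e : L).

(** * Restriction of congruences to subalgebras *)

Definition restrict theta B : set (L * L) := (theta `&` (B `*` B))%classic.

Lemma restrict_restrict theta A B :
  B `<=` A -> restrict (restrict theta A) B = restrict theta B.
Proof.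
move=> BA; apply/seteqP; split=> -[x y] /=; first by case=> -[].
by move=> [h [Bx By]]; do !split=> //=; exact: BA.
Qed.

Lemma lattice_congruence_restrict A B theta : B `<=` A -> sublattice B ->
  lattice_congruence A theta -> lattice_congruence B (restrict theta B).
Proof.
move=> BA Blat [_ r s t c]; split.
- by move=> [x y] [].
- by move=> x Bx; split=> //; exact/r/BA.
- by move=> x y [/s h [Bx By]].
- by move=> x y z [h [Bx _]] [k [_ Bz]]; split=> //; exact: t _ _ _ h k.
- move=> x y u v [h [/= Bx By]] [k [/= Bu Bv]].
  have [h1 h2] := c _ _ _ _ h k.
  have [] := Blat _ _ Bx Bu; have [] := Blat _ _ By Bv.
  by do !split.
Qed.

Lemma ms_congruence_restrict A B theta : B `<=` A -> ms_subalgebra B ->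
  ms_congruence A theta -> ms_congruence B (restrict theta B).
Proof.
move=> BA [_ _ Blat BN] [lc n]; split; first exact: lattice_congruence_restrict lc.
by move=> x y [h [/= Bx By]]; split; [exact: n | split; exact: BN].
Qed.

Lemma skeleton_sub A B : A `<=` B -> skeleton A `<=` skeleton B.
Proof. by move=> AB x [/AB]. Qed.

Lemma dense_sub A B : A `<=` B -> dense A `<=` dense B.
Proof. by move=> AB x [/AB]. Qed.

Lemma skeleton_subset A : skeleton A `<=` A. Proof. by move=> x []. Qed.

Lemma dense_subset A : dense A `<=` A. Proof. by move=> x []. Qed.

Lemma skeleton_neg A x : ms_subalgebra A -> A x -> skeleton A x°.
Proof. by move=> [_ _ _ AN] /AN; split=> //; rewrite ms_negnegneg. Qed.

Lemma dense_join A e x : ms_subalgebra A -> dense A e -> A x -> dense A (x `|` e).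
Proof.
move=> [_ _ Alat _] [Ae e0] Ax; split; first by have [] := Alat _ _ Ax Ae.
by rewrite ms_negU e0 meetx0.
Qed.

(** * The equality, full and join congruences *)

Definition diagonal A : set (L * L) := [set p | A p.1 /\ p.1 = p.2].

Lemma lattice_congruence_diagonal A :
  sublattice A -> lattice_congruence A (diagonal A).
Proof.
move=> Alat; split; first by move=> [x y] [/= Ax <-].
- by [].
- by move=> x y [/= Ax <-].
- by move=> x y z [/= Ax <-] [/= _ <-].
- by move=> x y u v [/= Ax <-] [/= Au <-]; have [] := Alat _ _ Ax Au.
Qed.

Lemma ms_congruence_diagonal A : ms_subalgebra A -> ms_congruence A (diagonal A).
Proof.
move=> [_ _ Alat AN]; split; first exact: lattice_congruence_diagonal.
by move=> x y [/= Ax <-]; split=> //=; exact: AN.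
Qed.

Lemma restrict_diagonal A B : B `<=` A -> restrict (diagonal A) B = diagonal B.
Proof.
move=> BA; apply/seteqP; split=> -[x y] /=; first by move=> [[_ ?] []].
by move=> [/= Bx <-]; do !split=> //=; exact: BA.
Qed.

Lemma lattice_congruenceX A : sublattice A -> lattice_congruence A (A `*` A).
Proof.
move=> Alat; split=> //.
- by move=> x y [].
- by move=> x y z [Ax _] [_ Az].
- move=> x y u v [/= Ax Ay] [/= Au Av].
  by have [] := Alat _ _ Ax Au; have [] := Alat _ _ Ay Av.
Qed.

(** This is the kernel of joining with [e], which by distributivity is a lattice homomorphism. *)
Definition join_congruence A e : set (L * L) :=
  [set p | (A p.1 /\ A p.2) /\ p.1 `|` e = p.2 `|` e].

Lemma lattice_congruence_join A e :
  sublattice A -> lattice_congruence A (join_congruence A e).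
Proof.
move=> Alat; rewrite /join_congruence; split; first by move=> ? [].
- by [].
- by move=> x y [[/= ? ?] ->].
- by move=> x y z [[/= ? ?] ->] [[/= ? ?] ->].
- move=> x y u v [/= [Ax Ay] h] [/= [Au Av] k].
  have [] := Alat _ _ Ax Au; have [] := Alat _ _ Ay Av.
  by do !split=> //=; [rewrite !joinIl h k | rewrite -[e]joinxx joinACA h k joinACA].
Qed.

(** * Gluing a skeleton congruence with a dense one *)

Definition glue A e theta1 theta2 : set (L * L) :=
  [set p | (A p.1 /\ A p.2) /\
           theta1 (p.1°, p.2°) /\ theta2 (p.1 `|` e, p.2 `|` e)].

(** Compatibility serves closure under negation: a pair in [glue] has its negations related by
    [theta1], and these must become related by [theta2] after joining with [e]. *)
Lemma ms_congruence_glue A e theta1 theta2 :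
    ms_subalgebra A -> dense A e ->
    ms_congruence (skeleton A) theta1 ->
    lattice_congruence (dense A) theta2 ->
    (forall a b, theta1 (a, b) -> theta2 (a `|` e, b `|` e)) ->
  ms_congruence A (glue A e theta1 theta2).
Proof.
move=> sA De [[_ r1 s1 t1 c1] n1] [_ r2 s2 t2 c2] comp.
have [_ _ Alat AN] := sA; split; last first.
  move=> x y [[/= Ax Ay] [h _]].
  by split; split=> /=; [exact: AN | exact: AN | exact: n1 | exact: comp].
split.
- by move=> ? [].
- move=> x Ax; do !split=> //; first exact/r1/skeleton_neg.
  exact/r2/dense_join.
- by move=> x y [[/= ? ?] [/s1 ? /s2 ?]].
- move=> x y z [[/= ? ?] [h1 h2]] [[/= ? ?] [k1 k2]].
  by do !split=> //; [exact: t1 _ _ _ h1 k1 | exact: t2 _ _ _ h2 k2].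
- move=> x y u v [[/= Ax Ay] [h1 h2]] [[/= Au Av] [k1 k2]].
  have [hI hU] := c1 _ _ _ _ h1 k1; have [kI kU] := c2 _ _ _ _ h2 k2.
  have [] := Alat _ _ Ax Au; have [] := Alat _ _ Ay Av.
  do !split=> //=; rewrite ?ms_negI ?ms_negU //; first by rewrite !joinIl.
  by rewrite joinACA joinxx [in X in (_, X)]joinACA joinxx in kU.
Qed.

Lemma ms_congruence_glueE A e theta : ms_subalgebra A -> dense A e ->
    (forall x, A x -> x = x°° `&` (x `|` e)) -> ms_congruence A theta ->
  glue A e (restrict theta (skeleton A)) (restrict theta (dense A)) = theta.
Proof.
move=> sA De decA [[sub r _ _ c] n]; apply/seteqP; split=> -[x y] /=.
  move=> [[/= Ax Ay] [[h _] [k _]]].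
  by rewrite (decA _ Ax) (decA _ Ay); have [] := c _ _ _ _ (n _ _ h) k.
move=> h; have [/= Ax Ay] := sub _ h; do !split=> //=.
- exact: n.
- by have [_ _ _ AN] := sA; exact: AN.
- by rewrite ms_negnegneg.
- by have [_ _ _ AN] := sA; exact: AN.
- by rewrite ms_negnegneg.
- by have [] := c _ _ _ _ h (r _ (dense_subset De)).
- by have [] := dense_join sA De Ax.
- by have [] := dense_join sA De Ax.
- by have [] := dense_join sA De Ay.
- by have [] := dense_join sA De Ay.
Qed.

Lemma restrict_glue A B e theta1 theta2 : B `<=` A -> ms_subalgebra B -> dense B e ->
  restrict (glue A e theta1 theta2) B =
  glue B e (restrict theta1 (skeleton B)) (restrict theta2 (dense B)).
Proof.
move=> BA sB De; apply/seteqP; split=> -[x y] /=.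
  move=> [[_ [/= h k]] [/= Bx By]].
  by split=> //; split; split=> //; split;
    do ?[exact: skeleton_neg | exact: dense_join].
move=> [[/= Bx By] [[h _] [k _]]]; do !split=> //=; exact: BA.
Qed.

(** [glue] tests [theta1] on [x°] and [y°]; one more negation returns to [x] and [y] when these are
    closed. *)
Lemma skeleton_restrict_glue A e theta1 theta2 :
    ms_subalgebra A -> dense A e -> ms_congruence (skeleton A) theta1 ->
    (forall a b, theta1 (a, b) -> theta2 (a `|` e, b `|` e)) ->
  restrict (glue A e theta1 theta2) (skeleton A) = theta1.
Proof.
move=> sA De [[sub _ _ _ _] n] comp; apply/seteqP; split=> -[x y] /=.
  by move=> [[_ [/n + _]] [[_ /= ex] [_ /= ey]]]; rewrite /= -ex -ey.
move=> h; have [/= [Ax ex] [Ay ey]] := sub _ h.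
by do !split=> //=; [exact: n | exact: comp].
Qed.

(** Dense elements have negation [\bot] and lie above [e], so the first test becomes
    [theta1 (\bot, \bot)] and joining with [e] changes nothing. *)
Lemma dense_restrict_glue A e theta1 theta2 :
    theta1 (\bot, \bot) -> dense A = [set x | A x /\ e <= x] ->
    lattice_congruence (dense A) theta2 ->
  restrict (glue A e theta1 theta2) (dense A) = theta2.
Proof.
move=> h0 DA [sub _ _ _ _]; have joinDe x : dense A x -> x `|` e = x.
  by rewrite DA => -[_ /join_idPl].
apply/seteqP; split=> -[x y] /=.
  by move=> [[_ [_ +]] [/= Dx Dy]]; rewrite /= !joinDe.
move=> h; have [/= Dx Dy] := sub _ h; have [Ax x0] := Dx; have [Ay y0] := Dy.
by do !split=> //=; rewrite ?x0 ?y0 ?joinDe.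
Qed.

Lemma perfect_extension_inj (Con : set L -> set (L * L) -> Prop) A B theta theta' :
    perfect_extension Con A B -> Con B (restrict theta B) ->
    Con A theta -> Con A theta' -> restrict theta B = restrict theta' B ->
  theta = theta'.
Proof.
move=> P cB c c' E; have [t [_ u]] := P _ cB.
by rewrite -(u theta) // -(u theta').
Qed.

(** The body of [principal] with its witness exposed, so that the generators of two algebras can be
    compared. *)
Definition generator A e : Prop :=
  [/\ A e, dense A = [set x | A x /\ e <= x] &
      forall x, A x -> x = x°° `&` (x `|` e)].

Lemma generator_dense A e : generator A e -> dense A e.
Proof. by move=> [Ae -> _]. Qed.

(** * Coincidence of the two generators *)

Section Generators.
Context {A B : set L} {e e' : L}.
Context (sA : ms_subalgebra A) (sB : ms_subalgebra B) (BA : B `<=` A).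
Context (gA : generator A e) (gB : generator B e').

Let De : dense A e := generator_dense gA.
Let De' : dense A e' := dense_sub BA (generator_dense gB).

Lemma generator_le : e <= e'.
Proof. by case: gA De' => _ -> _ []. Qed.

Lemma join_congruence_generator : join_congruence (dense A) e' (e, e').
Proof. by split=> //=; rewrite joinxx; apply/join_idPr/generator_le. Qed.

Lemma perfect_dense_generator :
  perfect_extension lattice_congruence (dense A) (dense B) -> e = e'.
Proof.
move=> P; have DBA := dense_sub BA.
have [sDA sDB] := (dense_sublattice sA, dense_sublattice sB).
have cj : lattice_congruence (dense A) (join_congruence (dense A) e').
  exact: lattice_congruence_join.
(* Elements of [dense B] lie above [e'], so both congruences restrict to equality there. *)
have E : join_congruence (dense A) e' = diagonal (dense A).
  apply: (perfect_extension_inj P) => //.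
  - exact: lattice_congruence_restrict cj.
  - exact: lattice_congruence_diagonal.
  rewrite restrict_diagonal //; apply/seteqP; split=> -[x y] /=.
    have joinDe' z : dense B z -> z `|` e' = z.
      by case: gB => _ -> _ [_ /join_idPl].
    by move=> [[_ /= +] [/= Dx Dy]]; rewrite !joinDe'.
  by move=> [/= Dx <-]; have Dx' := DBA _ Dx.
by have := join_congruence_generator; rewrite E => -[].
Qed.

Lemma perfect_generator : perfect_extension ms_congruence A B -> e = e'.
Proof.
move=> P; have sSA := skeleton_subalgebra sA.
pose theta := glue A e (diagonal (skeleton A)) (join_congruence (dense A) e').
have ct : ms_congruence A theta.
  apply: ms_congruence_glue => //; first exact: ms_congruence_diagonal.
    exact/lattice_congruence_join/dense_sublattice.
  move=> a b [/= [Aa _] <-]; split=> //=.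
  by split; apply: dense_join.
have E : theta = diagonal A.
  apply: (perfect_extension_inj P) => //.
  - exact: ms_congruence_restrict ct.
  - exact: ms_congruence_diagonal.
  rewrite restrict_diagonal //; apply/seteqP; split=> -[x y] /=.
    move=> [[_ [[_ /= n] [_ j0]]] [/= Bx By]]; split=> //=.
    (* As [e <= e'], the join with [e] made by [glue] is absorbed by [e']. With [x° = y°], the
       decomposition in [B] then yields [x = y]. *)
    have j : x `|` e' = y `|` e' by rewrite -(join_idPr generator_le) !joinA.
    by case: gB => _ _ decB; rewrite (decB _ Bx) (decB _ By) n j.
  by move=> [/= Bx <-]; have [_ r _ _ _] := ct.1; split=> //; exact/r/BA.
have [Ae e0] := De; have [Ae' e'0] := De'.
suff: theta (e, e') by rewrite E => -[].
split=> //; split=> /=.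
  by split=> /=; [exact: skeleton_neg | rewrite e0 e'0].
rewrite joinxx (join_idPl generator_le).
exact: join_congruence_generator.
Qed.

End Generators.

(** * Perfect extensions over a common generator *)

Section PerfectExtension.
Context {A B : set L} {e : L}.
Context (sA : ms_subalgebra A) (sB : ms_subalgebra B) (BA : B `<=` A).
Context (gA : generator A e) (gB : generator B e).

Let De : dense A e := generator_dense gA.
Let De' : dense B e := generator_dense gB.
Let sSA : ms_subalgebra (skeleton A) := skeleton_subalgebra sA.
Let sSB : ms_subalgebra (skeleton B) := skeleton_subalgebra sB.
Let sDA : sublattice (dense A) := dense_sublattice sA.
Let sDB : sublattice (dense B) := dense_sublattice sB.
Let SBA : skeleton B `<=` skeleton A := skeleton_sub BA.
Let DBA : dense B `<=` dense A := dense_sub BA.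

(** The full relation on the dense part is compatible with every [theta1]. *)
Lemma glue_full C theta1 : ms_subalgebra C -> dense C e ->
    ms_congruence (skeleton C) theta1 ->
  ms_congruence C (glue C e theta1 (dense C `*` dense C)) /\
  restrict (glue C e theta1 (dense C `*` dense C)) (skeleton C) = theta1.
Proof.
move=> sC DCe c1.
have comp a b : theta1 (a, b) -> (dense C `*` dense C) (a `|` e, b `|` e).
  by case: c1 => -[sub _ _ _ _] _ /sub[[/= Ca _] [Cb _]]; split; apply: dense_join.
split; last exact: skeleton_restrict_glue.
by apply: ms_congruence_glue => //; exact/lattice_congruenceX/dense_sublattice.
Qed.

(** Equality on the skeleton is compatible with every [theta2], by reflexivity. *)
Lemma glue_diagonal C theta2 : ms_subalgebra C -> generator C e ->
    lattice_congruence (dense C) theta2 ->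
  ms_congruence C (glue C e (diagonal (skeleton C)) theta2) /\
  restrict (glue C e (diagonal (skeleton C)) theta2) (dense C) = theta2.
Proof.
move=> sC gC c2; have DCe := generator_dense gC; have [_ DC _] := gC.
have sSC := skeleton_subalgebra sC; split.
  apply: ms_congruence_glue => //; first exact: ms_congruence_diagonal.
  move=> a _ [/= [Ca _] <-]; have [_ r _ _ _] := c2.
  exact/r/dense_join.
by apply: dense_restrict_glue => //; split=> //; case: sSC.
Qed.

Lemma perfect_extension_skeleton : perfect_extension ms_congruence A B ->
  perfect_extension ms_congruence (skeleton A) (skeleton B).
Proof.
move=> P phi cphi; have [cg rg] := glue_full sB De' cphi.
have [theta [[ct rt] _]] := P _ cg; rewrite -/(restrict _ _) in rt.
exists (restrict theta (skeleton A)); split.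
  split; first exact: ms_congruence_restrict (@skeleton_subset A) sSA ct.
  rewrite -/(restrict _ _) restrict_restrict //.
  by rewrite -(restrict_restrict _ (@skeleton_subset B)) rt rg.
(* Glued with the full relation, a competitor [theta1] extends the same congruence of [B] as
   [theta]; uniqueness on [A] identifies the two. *)
move=> theta1 [c1 r1]; have [cg1 rg1] := glue_full sA De c1.
suff -> : theta = glue A e theta1 (dense A `*` dense A) by [].
apply: (perfect_extension_inj P) => //; first by rewrite rt.
rewrite rt restrict_glue // /restrict r1; congr (glue _ _ _ _).
by apply/esym/setIidPr => -[x y] [/= /DBA ? /DBA].
Qed.

Lemma perfect_extension_dense : perfect_extension ms_congruence A B ->
  perfect_extension lattice_congruence (dense A) (dense B).
Proof.
move=> P phi cphi; have [cg rg] := glue_diagonal sB gB cphi.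
have [theta [[ct rt] _]] := P _ cg; rewrite -/(restrict _ _) in rt.
exists (restrict theta (dense A)); split.
  split; first exact: lattice_congruence_restrict (@dense_subset A) sDA ct.1.
  rewrite -/(restrict _ _) restrict_restrict //.
  by rewrite -(restrict_restrict _ (@dense_subset B)) rt rg.
move=> theta2 [c2 r2]; have [cg2 rg2] := glue_diagonal sA gA c2.
suff -> : theta = glue A e (diagonal (skeleton A)) theta2 by [].
apply: (perfect_extension_inj P) => //; first by rewrite rt.
by rewrite rt restrict_glue // restrict_diagonal // /restrict r2.
Qed.

(** The condition on negations makes this closed under negation: on closed elements, negating
    exchanges the two [theta2] conditions. *)
Definition compatible_part theta1 theta2 : set (L * L) :=
  [set p | theta1 p /\ theta2 (p.1 `|` e, p.2 `|` e) /\
           theta2 (p.1° `|` e, p.2° `|` e)].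

Lemma ms_congruence_compatible_part theta1 theta2 :
    ms_congruence (skeleton A) theta1 -> lattice_congruence (dense A) theta2 ->
  ms_congruence (skeleton A) (compatible_part theta1 theta2).
Proof.
move=> [[sub r1 s1 t1 c1] n1] [_ r2 s2 t2 c2]; split; last first.
  move=> x y [h [k l]]; have [[/= _ ex] [/= _ ey]] := sub _ h.
  by split; [exact: n1 | split=> //=; rewrite -ex -ey].
split.
- by move=> p [/sub].
- move=> x [Ax ex]; split; first exact: r1.
  by have [_ _ _ AN] := sA; split; apply/r2/dense_join => //; exact: AN.
- by move=> x y [/s1 ? [/s2 ? /s2 ?]].
- move=> x y z [h [k l]] [h' [k' l']].
  by split; [exact: t1 _ _ _ h h' | split; [exact: t2 _ _ _ k k' | exact: t2 _ _ _ l l']].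
- move=> x y u v [/= h [k l]] [/= h' [k' l']].
  have [hI hU] := c1 _ _ _ _ h h'; have [kI kU] := c2 _ _ _ _ k k'.
  have [lI lU] := c2 _ _ _ _ l l'.
  rewrite -!joinIl in kI lI.
  rewrite !(joinACA _ e) joinxx in kU lU.
  by do !split=> //=; rewrite ?ms_negI ?ms_negU.
Qed.

Lemma perfect_extension_glue :
    perfect_extension lattice_congruence (dense A) (dense B) ->
    perfect_extension ms_congruence (skeleton A) (skeleton B) ->
  perfect_extension ms_congruence A B.
Proof.
move=> PD PS phi cphi.
have [[_ _ decA] [_ _ decB]] := (gA, gB).
have cphi1 := ms_congruence_restrict (@skeleton_subset B) sSB cphi.
have cphi2 := lattice_congruence_restrict (@dense_subset B) sDB cphi.1.
have [theta1 [[c1 r1] u1]] := PS _ cphi1.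
have [theta2 [[c2 r2] u2]] := PD _ cphi2.
rewrite -!/(restrict _ _) in r1 r2.
(* The compatible part still extends [phi] on [skeleton B], so uniqueness of [theta1] forces
   equality, and hence compatibility. *)
have E : theta1 = compatible_part theta1 theta2.
  apply: u1; split; first exact: ms_congruence_compatible_part.
  rewrite -/(restrict _ _) -r1; apply/seteqP; split=> -[x y] /=.
    by move=> [[h _] k].
  move=> [h xy]; split=> //; split=> //.
  have [hxy [/= [Bx _] [By _]]] : restrict phi (skeleton B) (x, y) by rewrite -r1.
  have [[_ r _ _ c] n] := cphi; have [_ _ _ BN] := sB.
  have [Be _] := De'.
  (* Since [e] lies in [B], joining with it keeps a pair in [phi] and moves it into [dense B], where
     [theta2] agrees with [phi]. *)
  have join_e a b : B a -> B b -> phi (a, b) -> theta2 (a `|` e, b `|` e).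
    move=> Ba Bb ab.
    suff: restrict phi (dense B) (a `|` e, b `|` e) by rewrite -r2 => -[].
    split; first by have [] := c _ _ _ _ ab (r _ Be).
    by split; apply: dense_join.
  by split; apply: join_e => //=; [exact: BN | exact: BN | exact: n _ _ hxy].
exists (glue A e theta1 theta2); split.
  split; first by apply: ms_congruence_glue => // a b; rewrite E => -[_ []].
  by rewrite -/(restrict _ _) restrict_glue // r1 r2 ms_congruence_glueE.
(* Any other extension is the glue of its two parts, which extend the parts of [phi] and so are
   [theta1] and [theta2]. *)
move=> theta [ct rt]; rewrite -/(restrict _ _) in rt.
have restrictE C C' : C `<=` C' -> C `<=` B ->
    restrict (restrict theta C') C = restrict phi C.
  by move=> CC' CB; rewrite -rt !restrict_restrict.
rewrite -(ms_congruence_glueE sA De decA ct); congr (glue _ _ _ _).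
  apply: u1; split; first exact: ms_congruence_restrict (@skeleton_subset A) sSA ct.
  exact: restrictE SBA (@skeleton_subset B).
apply: u2; split; first exact: lattice_congruence_restrict (@dense_subset A) sDA ct.1.
exact: restrictE DBA (@dense_subset B).
Qed.

End PerfectExtension.

End CongruencePairs.

Theorem theorem4p4 (d : Order.disp_t) (L : msAlgebraType d) (L' : set L)
    (principalL : principal [set: L]%classic)
    (subL' : ms_subalgebra L')
    (principalL' : principal L') :
  perfect_extension ms_congruence [set: L]%classic L' <->
    (perfect_extension lattice_congruence
       (dense [set: L]%classic) (dense L') /\
     perfect_extension ms_congruence
       (skeleton [set: L]%classic) (skeleton L')).
Proof.
have [e Te [DT decT]] := principalL; have [e' L'e' [DL' decL']] := principalL'.
have gT : generator setT e by [].
have gL' : generator L' e' by [].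
have [sT sub] := (@ms_subalgebraT _ L, @subsetT _ L').
split=> [P | [PD PS]].
  have ee' := perfect_generator sT subL' sub gT gL' P; rewrite -ee' in gL'.
  by split; [exact: perfect_extension_dense gT gL' P
            | exact: perfect_extension_skeleton gT gL' P].
have ee' := perfect_dense_generator sT subL' sub gT gL' PD; rewrite -ee' in gL'.
exact: perfect_extension_glue gT gL' PD PS.
Qed.
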